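(* Let $\{a_j>b_j\in\mathbb N\}_{j=0,\dots,n}$ be an indexed set of pairs of natural numbers. Then $$R_{a_n,b_n}R_{a_{n-1},b_{n-1}}\cdots R_{a_0,b_0}=R_{A,B},$$ where $$A=\prod_{j=0}^n a_j\qquad\text{and}\qquad B=b_0+\sum_{j=1}^n\left(b_j\prod_{i=0}^{j-1}a_i\right).$$
   Context: $\mathbb N=\{0,1,2,\dots\}$. For $a>b\in\mathbb N$, $R_{a,b}$ is the partial injection on $\mathbb N$ with domain $\{an+b:n\in\mathbb N\}$ given by $R_{a,b}(n)=\frac{n-b}{a}$. Composition is composition of partial functions, with $fg$ meaning first $g$, then $f$. *)

(* Defs.v *)
From mathcomp Require Import all_boot.

Set Implicit Arguments.
Unset Strict Implicit.
Unset Printing Implicit Defensive.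

(* A partial function on nat is a map nat -> option nat, with None meaning
   "undefined"; pcomp f g (ssrfun) applies g first. *)
Definition partial_injective (f : nat -> option nat) : Prop :=
  forall x y z, f x = Some z -> f y = Some z -> x = y.

(* Meaningful only for b < a: see RP for its graph, which determines it. The
   guard b <= m is needed because subtraction on nat is truncated. *)
Definition R (a b : nat) : nat -> option nat :=
  fun m => if (b <= m) && (a %| m - b) then Some ((m - b) %/ a) else None.

Lemma RP (a b m n : nat) : b < a -> R a b m = Some n <-> m = a * n + b.
Proof.
move=> ltba; have a_gt0 : 0 < a by apply: leq_ltn_trans ltba.
rewrite /R; split=> [|->].
  case: ifP => // /andP[lebm dvd] [<-].
  by rewrite mulnC divnK // subnK.
by rewrite leq_addl addnK dvdn_mulr // mulKn.
Qed.

Lemma R_partial_injective (a b : nat) : b < a -> partial_injective (R a b).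
Proof. by move=> ltba x y z /(RP _ _ ltba)-> /(RP _ _ ltba)->. Qed.

(* f n \o ... \o f 1 \o f 0 *)
Fixpoint pcomp_upto (f : nat -> nat -> option nat) (n : nat) :
    nat -> option nat :=
  if n is n'.+1 then pcomp (f n) (pcomp_upto f n') else f 0.

(* Main.v *)
Require Import Defs.
From mathcomp Require Import all_boot.

(** [R a b] inverts the affine map k -> a * k + b, so a composite of such inverses inverts the
    affine maps composed in the opposite order; for two factors, a * (c * k + d) + b = a * c * k +
    (b + d * a), which is [pcomp_R]. Induction on [n] does the rest, carrying B < A because [RP]
    requires this bound. *)

(** A two-digit mixed-radix numeral, with low digit [b] in base [a] and high digit [d] in base
    [c]. *)
Lemma mixed_radix_ltn (a b c d : nat) : b < a -> d < c -> b + d * a < a * c.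
Proof.
move=> ltba ltdc; apply: (@leq_trans (d.+1 * a)); first by rewrite mulSn ltn_add2r.
by rewrite mulnC leq_mul2l ltdc orbT.
Qed.

Lemma pcomp_R (a b c d : nat) : b < a -> d < c ->
  pcomp (R c d) (R a b) =1 R (a * c) (b + d * a).
Proof.
move=> ltba ltdc m; have ltBA := mixed_radix_ltn _ _ _ _ ltba ltdc.
have E k : pcomp (R c d) (R a b) m = Some k <-> R (a * c) (b + d * a) m = Some k.
  have Em : a * c * k + (b + d * a) = a * (c * k + d) + b.
    by rewrite mulnDr mulnA -addnA [b + _]addnC [d * a]mulnC.
  apply: iff_trans (iff_sym (RP _ _ ltBA)); rewrite Em /pcomp.
  split=> [|/(RP _ _ ltba) ->]; last exact/RP.
  by case El: (R a b m) => [l|] //= /(RP _ _ ltdc) <-; apply/RP.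
(* Equal graphs force equal option values: by [E], [None] on the left excludes [Some] on the
   right. *)
case El: (pcomp _ _ m) => [k|]; first by move/E: El.
by case Er: (R _ _ m) => [k|] //; move/E: Er; rewrite El.
Qed.

Theorem lemma26 (n : nat) (a b : nat -> nat)
    (hab : forall j : nat, j <= n -> b j < a j) :
  let A := \prod_(0 <= j < n.+1) a j in
  let B := b 0 + \sum_(1 <= j < n.+1) b j * \prod_(0 <= i < j) a i in
  B < A /\ pcomp_upto (fun j => R (a j) (b j)) n =1 R A B.
Proof.
elim: n hab => [|n IHn] hab /=.
  by rewrite big_nat1 big_geq // addn0; split=> //; apply: hab.
have [j lejn|ltBA IH] := IHn; first exact/hab/leqW.
have ltba := hab _ (leqnn n.+1).
(* With A and B the values at [n], this exposes A * a n.+1 and B + b n.+1 * A, the shape in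
   [pcomp_R]. *)
rewrite !(@big_nat_recr _ _ _ n.+1) //= addnA.
split=> [|m]; first exact: mixed_radix_ltn.
by rewrite -pcomp_R // /pcomp IH.
Qed.
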